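(* (a) Let $V$ be a countable vertex set and let $(c_t)_{t\in\mathbb{N}}$ be a deterministic sequence of symmetric conductances on $V$ that is non-decreasing in $t$ (i.e. $c_t(u,v)\le c_{t+1}(u,v)$ for all $u,v\in V$, $t\ge 0$) with limit $c_\infty$ (i.e. $c_t(u,v)\uparrow c_\infty(u,v)$ for all $u,v$), where $\pi_\infty(v)=\sum_{z} c_\infty(v,z)<\infty$ for every $v\in V$. Let $(X_t)_{t\ge 0}$ be the random walk in the changing environment $(c_t)_{t\ge0}$ started at an arbitrary vertex. If the (time-homogeneous) random walk on $(V,c_\infty)$ is irreducible and recurrent, then $(X_t)_{t\ge0}$ is recurrent: almost surely, for every $v\in V$, $X_t=v$ for infinitely many $t$. (b) Consequently: let $G_\infty$ be a fixed graph of uniformly bounded degrees, let $(G_t)_{t\in\mathbb{N}}$ be any non-decreasing sequence of graphs with $G_t\uparrow G_\infty$ (the edge set of $G_\infty$ is the increasing union of the edge sets of the $G_t$), and let $v_0$ be a vertex. If simple random walk on $G_\infty$ started at $v_0$ is recurrent, then simple random walk on $(G_t)_{t\ge0}$ started at $v_0$ (whose $t$-th step, from time $t$ to time $t+1$, is a simple random walk step on $G_t$) almost surely returns to $v_0$ infinitely often.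
   Context: A network $(V,c)$ is a countable vertex set $V$ with symmetric conductances $c:V\times V\to[0,\infty)$; its edges are the pairs $e$ with $c(e)>0$. The total conductance of a vertex is $\pi(y)=\sum_z c(y,z)$, assumed finite at every vertex; vertices may have infinitely many neighbors. The random walk on $(V,c)$ at $y$ jumps to $z$ with probability $c(y,z)/\pi(y)$; if $\pi(y)=0$ it stays at $y$. The random walk $(X_t)_{t\ge 0}$ in the changing environment $(c_t)_{t\ge0}$ is the time-inhomogeneous Markov chain with $\mathbb{P}(X_{t+1}=z\mid X_t=y)=c_t(y,z)/\pi_t(y)$, where $\pi_t(y)=\sum_z c_t(y,z)$, and $X_{t+1}=X_t$ if $\pi_t(X_t)=0$. Simple random walk on a graph is the case of $\{0,1\}$-valued conductances. *)

(* Defs.v *)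
From HB Require Import structures.
From mathcomp Require Import all_boot all_order all_algebra.
From mathcomp Require Import all_classical all_reals all_analysis.
Set Implicit Arguments.
Unset Strict Implicit.
Unset Printing Implicit Defensive.
Import Order.TTheory GRing.Theory Num.Theory.
Import numFieldNormedType.Exports.
Local Open Scope classical_set_scope.
Local Open Scope ring_scope.

Section Networks.
Context {R : realType} {V : countType}.
Implicit Types (c : V -> V -> R) (p : V -> V -> R) (x y z : V).

(* Loops c x x > 0 are allowed. *)
Definition conductances c : Prop :=
  (forall x y, 0 <= c x y) /\ (forall x y, c x y = c y x).

Definition total_cond c y : \bar R := \esum_(z in [set: V]) (c y z)%:E.

Definition finite_total_cond c : Prop := forall y, (total_cond c y < +oo)%E.

(* Only meaningful when total_cond c y is finite, because of fine. *)
Definition transition c y z : R :=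
  if fine (total_cond c y) == 0 then (y == z)%:R
  else c y z / fine (total_cond c y).

Fixpoint nstep p (n : nat) x y : \bar R :=
  if n is m.+1 then \esum_(z in [set: V]) ((p x z)%:E * nstep p m z y)%E
  else ((x == y)%:R)%:E.

Definition irreducible p : Prop :=
  forall x y, exists n : nat, (0 < nstep p n x y)%E.

(* As V is countable, measurability of the fibers is measurability for the
   discrete sigma-algebra.  The last clause is
     P(X_(t+1) = x_(t+1) | X_t = x_t, ..., X_0 = x_0) = p_t(x_t, x_(t+1))
   multiplied out, so that it also makes sense on null events. *)
Definition markov_chain d (T : measurableType d) (P : probability T R)
    (X : nat -> T -> V) (p : nat -> V -> V -> R) (v : V) : Prop :=
  [/\ forall t y, measurable [set w | X t w = y],
      P [set w | X 0%N w = v] = 1%E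
    & forall (t : nat) (x : nat -> V),
        P [set w | forall s, (s <= t.+1)%N -> X s w = x s] =
        (P [set w | forall s, (s <= t)%N -> X s w = x s]
         * (p t (x t) (x t.+1))%:E)%E].

Definition random_walk d (T : measurableType d) (P : probability T R)
    (X : nat -> T -> V) (c : nat -> V -> V -> R) (v : V) : Prop :=
  markov_chain P X (fun t => transition (c t)) v.

(* The law of the walk on (V, c) started at v is determined by c and v, so it
   does not matter which realization is used: "some" and "every" realization
   give the same notion. *)
Definition recurrent_at c v : Prop :=
  exists (d : measure_display) (T : measurableType d) (P : probability T R)
         (X : nat -> T -> V),
    random_walk P X (fun=> c) v /\
    {ae P, forall w, infinite_set [set t | X t w = v]}.

Definition recurrent c : Prop := forall v, recurrent_at c v.

End Networks.

(* A graph on V is given by its symmetric adjacency relation. *)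
Definition graph_cond (R : realType) (V : countType) (e : rel V) : V -> V -> R :=
  fun x y => (e x y)%:R.

Definition bounded_degree (V : countType) (e : rel V) : Prop :=
  exists D : nat, forall x, ([set y | e x y] #<= `I_D)%card.

(* Main.v *)
(* Fix a target o and kill the walk when it hits o after time t.  Let mu_n be
   the law of the killed walk, f_n = mu_n / pi_n its density, and
   G_n = sum_(k >= n) f_k.  Since c_n increases, summation by parts writes
   sum_n E_n(f_n, phi) as sum_n (E_n - E_(n-1))(G_n, phi), where the increments
   E_n - E_(n-1) of the Dirichlet forms are positive semidefinite.  The same
   summation gives sum_n (E_n - E_(n-1))(G_n, G_n) <= 2 <mu_0, G_0>, which is
   finite because the expected number of visits to the starting point before
   hitting o is finite.  Hence the total flow of the walk has finite energy for
   c_oo.  Testing it against potentials phi with phi(o) = 1, phi(x) -> 1 and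
   energy tending to 0, which exist by recurrence, shows that no mass survives.
   All forms are restricted to a finite set B, so only finite sums occur. *)

Require Import Defs.
From HB Require Import structures.
From mathcomp Require Import all_boot all_order all_algebra.
From mathcomp Require Import all_classical all_reals all_analysis.
From mathcomp Require Import ring lra.
Set Implicit Arguments.
Unset Strict Implicit.
Unset Printing Implicit Defensive.
Import Order.TTheory GRing.Theory Num.Theory.
Import numFieldNormedType.Exports.
Local Open Scope classical_set_scope.
Local Open Scope ring_scope.

(** * Dirichlet forms on finite sets *)

Section Energy.
Context {R : realType} {V : countType}.
Variable B : seq V.
Implicit Types (w f g h : V -> R) (c : V -> V -> R).

(** With [w] the total conductance over all of [V] and [B] duplicate-free, this is the Dirichlet
    form of functions cut off to zero outside [B]: an edge leaving [B] contributes only through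
    [w]. *)
Definition energy w c f g : R :=
  \sum_(x <- B) w x * f x * g x
  - \sum_(x <- B) \sum_(y <- B) c x y * f x * g y.

(** If [w * f] is a mass distribution, the bracket is the mass at [y] minus the mass that one step
    from [B] sends to [y]. *)
Lemma energyE w c f g :
  energy w c f g =
  \sum_(y <- B) (w y * f y - \sum_(x <- B) f x * c x y) * g y.
Proof.
rewrite /energy exchange_big -sumrB /=.
by apply: eq_bigr => y _; rewrite mulrBl mulr_suml; congr (_ - _);
   apply: eq_bigr => x _; ring.
Qed.

Lemma energyC w c f g : (forall x y, c x y = c y x) ->
  energy w c f g = energy w c g f.
Proof.
move=> cC; rewrite /energy [X in _ - X]exchange_big /=.
by congr (_ - _); apply: eq_bigr => x _; [ring|apply: eq_bigr => y _; rewrite cC; ring].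
Qed.

Lemma energy_combr w c f g h (a b : R) :
  energy w c f (fun y => a * g y + b * h y) =
  a * energy w c f g + b * energy w c f h.
Proof.
rewrite !energyE !mulr_sumr -big_split /=; apply: eq_bigr => y _; ring.
Qed.

Lemma energy_combl w c f g h (a b : R) :
  energy w c (fun y => a * g y + b * h y) f =
  a * energy w c g f + b * energy w c h f.
Proof.
rewrite /energy !mulrBr !mulr_sumr [RHS]addrACA -opprD -!big_split /=.
congr (_ - _); apply: eq_bigr => y _; first ring.
by rewrite !mulr_sumr -big_split /=; apply: eq_bigr => z _; ring.
Qed.

Lemma energy_sqrD w c f h (a : R) : (forall x y, c x y = c y x) ->
  energy w c (fun y => 1 * h y + a * f y) (fun y => 1 * h y + a * f y)
  - energy w c h h = a ^+ 2 * energy w c f f + 2 * a * energy w c f h.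
Proof.
by move=> cC; rewrite energy_combr !energy_combl (energyC w h f cC); ring.
Qed.

Lemma energy_subl w w' c c' f g :
  energy w' c' f g - energy w c f g =
  energy (fun x => w' x - w x) (fun x y => c' x y - c x y) f g.
Proof.
rewrite !energyE -sumrB; apply: eq_bigr => y _.
rewrite -mulrBl; congr (_ * _).
rewrite [in RHS](eq_bigr (fun x => f x * c' x y - f x * c x y)); last first.
  by move=> x _; rewrite mulrBr.
rewrite sumrB; ring.
Qed.

(** Twice the energy is a nonnegative killing term plus the sum over ordered pairs of
    [c u v * (f u - f v) ^+ 2]; a single pair is kept. *)
Lemma energy_ge_edge w c f x y :
  (forall u v, 0 <= c u v) -> (forall u v, c u v = c v u) ->
  (forall u, \sum_(v <- B) c u v <= w u) ->
  x \in B -> y \in B ->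
  c x y * (f x - f y) ^+ 2 <= 2 * energy w c f f.
Proof.
move=> c0 cC cw xB yB.
have -> : 2 * energy w c f f =
  2 * (\sum_(u <- B) (w u - \sum_(v <- B) c u v) * f u ^+ 2) +
  \sum_(u <- B) \sum_(v <- B) c u v * (f u - f v) ^+ 2.
  have -> : \sum_(u <- B) \sum_(v <- B) c u v * (f u - f v) ^+ 2 =
    \sum_(u <- B) \sum_(v <- B) c u v * f u ^+ 2 +
    \sum_(u <- B) \sum_(v <- B) c v u * f v ^+ 2 +
    (- 2) * \sum_(u <- B) \sum_(v <- B) c u v * f u * f v.
    rewrite mulr_sumr -!big_split /=; apply: eq_bigr => u _.
    rewrite mulr_sumr -!big_split /=; apply: eq_bigr => v _.
    by rewrite (cC v u); ring.
  rewrite (exchange_big _ _ _ _ _ (fun u v => c v u * f v ^+ 2)) /=.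
  rewrite (eq_bigr (fun u => w u * f u * f u - \sum_(v <- B) c u v * f u ^+ 2)); last first.
    by move=> u _; rewrite mulrBl mulr_suml; congr (_ - _); ring.
  rewrite sumrB /energy; ring.
have t0 u v : 0 <= c u v * (f u - f v) ^+ 2 by rewrite mulr_ge0 // sqr_ge0.
rewrite -[leLHS]add0r; apply: lerD.
  apply: mulr_ge0 => //; apply: sumr_ge0 => u _.
  by rewrite mulr_ge0 ?sqr_ge0 // subr_ge0.
rewrite (big_rem x) //= (big_rem y) //= -[leLHS]addr0 -addrA lerD2l.
by rewrite addr_ge0 ?sumr_ge0 // => u _; rewrite sumr_ge0.
Qed.

Lemma energy_ge0 w c f :
  (forall u v, 0 <= c u v) -> (forall u v, c u v = c v u) ->
  (forall u, \sum_(v <- B) c u v <= w u) ->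
  0 <= energy w c f f.
Proof.
move=> c0 cC cw.
have [B0|[x xB]] : B = [::] \/ exists x, x \in B.
    by case: B => [|x s]; [left|right; exists x; exact: mem_head].
  by rewrite /energy B0 !big_nil subrr.
have := energy_ge_edge f c0 cC cw xB xB.
by rewrite subrr expr0n mulr0 pmulr_rge0.
Qed.

Lemma energy_le w w' c c' f :
  (forall u v, c u v <= c' u v) ->
  (forall u v, c u v = c v u) -> (forall u v, c' u v = c' v u) ->
  (forall u, \sum_(v <- B) (c' u v - c u v) <= w' u - w u) ->
  energy w c f f <= energy w' c' f f.
Proof.
move=> cc' cC cC' cw; rewrite -subr_ge0 energy_subl; apply: energy_ge0 => //.
  by move=> u v; rewrite subr_ge0.
by move=> u v; rewrite cC cC'.
Qed.

(* Completing the square: the increments of the forms [energy (w n) (c n)] are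
   positive semidefinite, and are applied to [eps * G n - phi]. *)
Lemma energy_flow_bound (w : nat -> V -> R) (c : nat -> V -> V -> R)
    (f G : nat -> V -> R) (phi : V -> R) (eps : R) (N : nat) :
  (forall y, G N y = 0) ->
  (forall n y, (n < N)%N -> G n y = f n y + G n.+1 y) ->
  (forall n u v, 0 <= c n u v) -> (forall n u v, c n u v = c n v u) ->
  (forall n u v, c n u v <= c n.+1 u v) ->
  (forall u, \sum_(v <- B) c 0%N u v <= w 0%N u) ->
  (forall n u, \sum_(v <- B) (c n.+1 u v - c n u v) <= w n.+1 u - w n u) ->
  2 * eps * \sum_(n < N) energy (w n) (c n) (f n) phi <=
  eps ^+ 2 * \sum_(n < N) energy (w n) (c n) (f n) (fun y => G n y + G n.+1 y)
  + energy (w N) (c N) phi phi.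
Proof.
move=> GN GS c0 cC cS w0 wS.
pose E n := energy (w n) (c n).
pose h n y := eps * G n y + (-1) * phi y.
have hN : E N (h N) (h N) = E N phi phi.
  rewrite (_ : h N = fun y => 0 * phi y + (-1) * phi y).
    by rewrite /E energy_combl energy_combr; ring.
  by apply/funext => y; rewrite /h GN mulr0 mul0r.
(* The left side equals [E 0 (h 0) (h 0)] plus the increments [E k.+1 - E k] evaluated at [h k.+1],
   all nonnegative. *)
have inc n : 0 <= \sum_(k < n) (E k (h k) (h k) - E k (h k.+1) (h k.+1)) + E n (h n) (h n).
  elim: n => [|n IH]; first by rewrite big_ord0 add0r; exact: energy_ge0.
  apply: (le_trans IH); rewrite big_ord_recr /= -subr_ge0.
  have le : E n (h n.+1) (h n.+1) <= E n.+1 (h n.+1) (h n.+1) by exact: energy_le.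
  lra.
have := inc N; rewrite hN.
(* Expand [h k = h k.+1 + eps * f k]; the part quadratic in [eps] combines [f k + 2 * G k.+1] into
   [G k + G k.+1]. *)
rewrite (eq_bigr (fun k : 'I_N => eps ^+ 2 * E k (f k) (fun y => G k y + G k.+1 y)
    - 2 * eps * E k (f k) phi)); last first.
  move=> k _.
  have -> : h k = fun y => 1 * h k.+1 y + eps * f k y.
    apply/funext => y; rewrite /h (GS k _ (ltn_ord k)); ring.
  have -> : (fun y => G k y + G k.+1 y) = fun y => 2 * G k.+1 y + 1 * f k y.
    apply/funext => y; rewrite (GS k _ (ltn_ord k)); ring.
  by rewrite /E energy_sqrD // energy_combr /h energy_combr; ring.
rewrite sumrB -!mulr_sumr /E; lra.
Qed.

End Energy.

(** * Densities of killed walks *)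

Section Weights.
Context {R : realType} {V : countType}.
Implicit Types (c : V -> V -> R) (B : seq V).

Definition weight c y : R := fine (total_cond c y).

Lemma total_cond_ge_sum c B y : (forall x z, 0 <= c x z) -> uniq B ->
  ((\sum_(z <- B) c y z)%:E <= total_cond c y)%E.
Proof.
move=> c0 uB; rewrite /total_cond; apply: esum_ge.
exists [set` B]; first by split => //; exact: finite_seq.
by rewrite -sumEFin fsbig_seq.

Qed.

Lemma total_cond_fin c y : (forall x z, 0 <= c x z) -> finite_total_cond c ->
  total_cond c y \is a fin_num.
Proof.
by move=> c0 cfin; rewrite ge0_fin_numE //; apply: esum_ge0 => z _; rewrite lee_fin.
Qed.

Lemma sum_le_weight c B y : (forall x z, 0 <= c x z) -> finite_total_cond c ->
  uniq B -> \sum_(z <- B) c y z <= weight c y.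
Proof.
move=> c0 cfin uB; rewrite -lee_fin /weight fineK ?total_cond_fin //.
exact: total_cond_ge_sum.
Qed.

Lemma finite_total_cond_le c c' : (forall x z, c x z <= c' x z) ->
  finite_total_cond c' -> finite_total_cond c.
Proof.
move=> cc' fin y; apply: le_lt_trans (fin y).
by rewrite /total_cond; apply: le_esum => z _; rewrite lee_fin.
Qed.

(** The increments [c' - c] are nonnegative, and their weight is the difference of the two
    weights. *)
Lemma sum_sub_le_weight c c' B y :
  (forall x z, 0 <= c x z) -> (forall x z, c x z <= c' x z) ->
  finite_total_cond c' -> uniq B ->
  \sum_(z <- B) (c' y z - c y z) <= weight c' y - weight c y.
Proof.
move=> c0 cc' fin uB.
have d0 x z : 0 <= c' x z - c x z by rewrite subr_ge0.
have dfin : finite_total_cond (fun x z => c' x z - c x z).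
  by apply: finite_total_cond_le fin => x z; rewrite gerBl.
have cfin := finite_total_cond_le cc' fin.
suff -> : weight c' y = weight c y + weight (fun x z => c' x z - c x z) y.
  by rewrite [leRHS]addrAC subrr add0r; exact: sum_le_weight.
rewrite /weight -fineD ?total_cond_fin //; congr fine.
rewrite /total_cond -esumD; first by apply: eq_esum => z _; rewrite -EFinD addrC subrK.
- by move=> z _; rewrite lee_fin.
- by move=> z _; rewrite lee_fin.
Qed.

Lemma weight_ge0 c y : (forall x z, 0 <= c x z) -> 0 <= weight c y.
Proof. by move=> c0; apply/fine_ge0/esum_ge0 => z _; rewrite lee_fin. Qed.

Lemma weight_le c c' y :
  (forall x z, 0 <= c x z) -> (forall x z, c x z <= c' x z) ->
  finite_total_cond c' -> weight c y <= weight c' y.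
Proof.
move=> c0 cc' fin; rewrite -subr_ge0.
by have := sum_sub_le_weight y c0 cc' fin (erefl (uniq [::])); rewrite big_nil.
Qed.

Lemma cond_le_weight c y z : (forall x z, 0 <= c x z) -> finite_total_cond c ->
  c y z <= weight c y.
Proof.
by move=> c0 fin; have := @sum_le_weight c [:: z] y c0 fin isT; rewrite big_seq1.
Qed.

Lemma transition_ge0 c y z : (forall x z, 0 <= c x z) -> 0 <= transition c y z.
Proof.
move=> c0; rewrite /transition; case: ifP => _ //.
by rewrite divr_ge0 //; exact: weight_ge0.
Qed.

Lemma transition_weight0 c y z : weight c y = 0 -> transition c y z = (y == z)%:R.
Proof. by rewrite /transition -/(weight c y) => ->; rewrite eqxx. Qed.

Lemma transition_weight c y z : weight c y != 0 ->
  transition c y z = c y z / weight c y.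
Proof. by rewrite /transition -/(weight c y) => /negPf ->. Qed.

End Weights.

(* [m n] is the law at time [n] of a walk killed at [o] at times [n > 0], and
   [s n] is its total mass; only the inequalities that the argument uses are
   recorded. *)
Definition killed_walk (R : realType) (V : countType) (c : nat -> V -> V -> R)
    (x o : V) (m : nat -> V -> R) (s : nat -> R) : Prop :=
  [/\ forall n y, 0 <= m n y /\ m n.+1 o = 0, s 0%N <= m 0%N x,
      forall n, 0 <= s n,
      forall n y (B : seq V), uniq B -> y != o ->
        \sum_(z <- B) m n z * transition (c n) z y <= m n.+1 y
    & forall n (B : seq V), uniq B ->
        \sum_(z <- B) m n z * transition (c n) z o <= s n - s n.+1].

(** * Energy estimate for the flow of a killed walk *)

Section KilledFlow.
Context {R : realType} {V : countType}.
Variables (c : nat -> V -> V -> R) (x o : V) (m : nat -> V -> R) (s : nat -> R).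
Hypothesis c_cond : forall n, conductances (c n).
Hypothesis cS : forall n u v, c n u v <= c n.+1 u v.
Hypothesis cfin : forall n, finite_total_cond (c n).
Hypothesis ms : killed_walk c x o m s.
Hypothesis wx : 0 < weight (c 0%N) x.
Variables (B : seq V) (uB : uniq B) (xB : x \in B) (oB : o \in B).

Let c0 n u v : 0 <= c n u v. Proof. exact: (c_cond n).1. Qed.
Let cC n u v : c n u v = c n v u. Proof. exact: (c_cond n).2. Qed.
Let w n := weight (c n).

(** Density, relative to the current weights, of the walk started with mass [m 0 x] at [x] and
    killed at [o] at positive times; mass outside [B] is not passed on. *)
Fixpoint density n y : R :=
  if n is k.+1 then
    if y == o then 0 else (\sum_(z <- B) density k z * c k z y) / w n y
  else if y == x then m 0%N x / w 0%N x else 0.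

Let outflow n y := \sum_(z <- B) density n z * c n z y.
Let mass n y := w n y * density n y.

Let w_ge0 n y : 0 <= w n y. Proof. exact: weight_ge0. Qed.

Let density_ge0 n y : 0 <= density n y.
Proof.
have m0 k v : 0 <= m k v by have [/(_ k v)[]] := ms.
elim: n y => [|n IH] y /=; first by case: ifP => // _; rewrite divr_ge0 // ltW.
case: ifP => // _; rewrite divr_ge0 // sumr_ge0 // => z _; exact: mulr_ge0.
Qed.

Let outflow_ge0 n y : 0 <= outflow n y.
Proof. by rewrite sumr_ge0 // => z _; rewrite mulr_ge0. Qed.

Let massS n y : mass n.+1 y = if y == o then 0 else outflow n y.
Proof.
rewrite /mass /=; case: ifP => _; first by rewrite mulr0.
have [w0|w0] := eqVneq (w n.+1 y) 0; last by rewrite mulrC divfK.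
(* A vertex without weight at time [n.+1] has no edge at time [n] either, so the convention that
   division by zero gives zero loses no mass. *)
rewrite w0 mul0r /outflow big1 // => z _.
suff -> : c n z y = 0 by rewrite mulr0.
apply/eqP; rewrite eq_le c0 andbT (le_trans (cS n z y)) // cC -w0.
exact: cond_le_weight.
Qed.

Let mass_ge0 n y : 0 <= mass n y. Proof. exact: mulr_ge0. Qed.

Let mass_le_outflow n y : mass n.+1 y <= outflow n y.
Proof. by rewrite massS; case: ifP. Qed.

Let step_le n y z : mass n z <= m n z ->
  density n z * c n z y <= m n z * transition (c n) z y.
Proof.
have m0 k v : 0 <= m k v by have [/(_ k v)[]] := ms.
move=> le; have [wz|wz] := eqVneq (w n z) 0.
  rewrite (_ : c n z y = 0) ?mulr0 ?mulr_ge0 ?transition_ge0 //.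
  by apply/eqP; rewrite eq_le c0 andbT -wz; exact: cond_le_weight.
rewrite transition_weight // mulrA mulrAC ler_wpM2r //.
have wz0 : 0 < w n z by rewrite lt_def wz /=.
by rewrite ler_pdivlMr // mulrC.
Qed.

Let mass_le n y : mass n y <= m n y.
Proof.
have m0 k v : 0 <= m k v by have [/(_ k v)[]] := ms.
have [_ _ _ mS _] := ms.
elim: n y => [|n IH] y.
  rewrite /mass /=; case: eqP => [->|_]; last by rewrite mulr0.
  by rewrite mulrC divfK // gt_eqF.
rewrite massS; case: ifPn => [_|yo]; first exact: m0.
by apply: le_trans (mS n y B uB yo); apply: ler_sum => z _; exact: step_le.
Qed.

Let energy_density n g :
  energy B (w n) (c n) (density n) g =
  \sum_(y <- B) (mass n y - outflow n y) * g y.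
Proof. by rewrite energyE. Qed.

(** Pairing the flow with [phi] gives the mass put at [x], minus what remains at time [N], minus
    what reaches [o]; the last is at most [s 0 - s N]. [energy_flow_bound] controls the pairing from
    above, with [eps] balancing the energy of the flow against that of [phi]. *)
Lemma survival_bound (phi : V -> R) (eps C : R) (N : nat) :
  0 < eps -> (forall y, 0 <= phi y) -> phi o = 1 ->
  \sum_(n < N) m n x <= C ->
  s N <= \sum_(y <- B) m N y * phi y + m 0%N x * (1 - phi x)
         + eps * (m 0%N x * (C / w 0%N x))
         + energy B (w N) (c N) phi phi / (2 * eps).
Proof.
move=> eps0 phi0 phio mC; have [_ s0 _ mS mo] := ms.
have m0 k v : 0 <= m k v by have [/(_ k v)[]] := ms.
pose G n y := \sum_(n <= k < N) density k y.
have GN y : G N y = 0 by rewrite /G big_geq.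
have GS n y : (n < N)%N -> G n y = density n y + G n.+1 y.
  by move=> nN; rewrite /G big_ltn.
have G_ge0 n y : 0 <= G n y by rewrite sumr_ge0.
have key := energy_flow_bound phi eps GN GS c0 cC cS
  (fun u => sum_le_weight u (c0 0%N) (cfin 0%N) uB)
  (fun n u => sum_sub_le_weight u (c0 n) (cS n) (cfin n.+1) uB).
have mass0 g : \sum_(y <- B) mass 0%N y * g y = m 0%N x * g x.
  rewrite (big_rem x) //= big_seq big1 ?addr0.
    by congr (_ * _); rewrite /mass /= eqxx mulrC divfK // gt_eqF.
  move=> y; rewrite mem_rem_uniq // inE => /andP[/negPf yx _].
  by rewrite /mass /= yx mulr0 mul0r.
have self : \sum_(n < N) energy B (w n) (c n) (density n)
    (fun y => G n y + G n.+1 y) <= 2 * (m 0%N x * (C / w 0%N x)).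
  pose A n := \sum_(y <- B) mass n y * G n y.
  have AN : A N = 0 by rewrite /A big1 // => y _; rewrite GN mulr0.
  (* Weights increase, so [w 0 x * G 0 x] is at most the sum of the masses at [x], hence at most
     [C]. *)
  have A0 : A 0%N <= m 0%N x * (C / w 0%N x).
    rewrite /A mass0 ler_wpM2l // /G big_mkord ler_pdivlMr // mulrC mulr_sumr.
    apply: le_trans mC; apply: ler_sum => n _.
    apply: le_trans (mass_le n x); rewrite ler_wpM2r //.
    elim: (n : nat) => // k IH; apply: (le_trans IH).
    exact: weight_le.
  apply: (@le_trans _ _ (\sum_(n < N) 2 * (A n - A n.+1))).
    apply: ler_sum => n _; rewrite energy_density /A -sumrB mulr_sumr.
    apply: ler_sum => y _; rewrite (GS n y (ltn_ord n)) -subr_ge0.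
    (* Termwise, the difference of the two sides is [h1 + h2 + 2 * h3]. *)
    have h1 := mulr_ge0 (mass_ge0 n y) (density_ge0 n y).
    have h2 := mulr_ge0 (outflow_ge0 n y) (density_ge0 n y).
    have h3 : 0 <= (outflow n y - mass n.+1 y) * G n.+1 y.
      by rewrite mulr_ge0 // subr_ge0.
    lra.
  rewrite -mulr_sumr -(big_mkord xpredT (fun n => A n - A n.+1)) /=.
  rewrite (telescope_sumr_eq (fun n => - A n)) //; last by move=> n _; rewrite opprK addrC.
  rewrite AN oppr0 add0r opprK; lra.
have lin : m 0%N x * phi x - \sum_(y <- B) m N y * phi y - (s 0%N - s N)
    <= \sum_(n < N) energy B (w n) (c n) (density n) phi.
  pose A n := \sum_(y <- B) mass n y * phi y.
  have step n : A n - A n.+1 - (s n - s n.+1) <= energy B (w n) (c n) (density n) phi.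
    rewrite energy_density.
    (* As [phi o = 1] and [mass n.+1 o = 0], the term at [o] leaves exactly the flow absorbed at
       [o]. *)
    have -> : \sum_(y <- B) (mass n y - outflow n y) * phi y = A n - A n.+1 - outflow n o.
      rewrite /A -sumrB (big_rem o) //= [in RHS](big_rem o) //= massS eqxx phio.
      rewrite (eq_big_seq (fun y => mass n y * phi y - mass n.+1 y * phi y)); first ring.
      move=> y; rewrite mem_rem_uniq // inE => /andP[/negPf yo _].
      by rewrite massS yo mulrBl.
    rewrite lerD2l lerN2; apply: le_trans (mo n B uB).
    by apply: ler_sum => z _; apply: step_le.
  apply: le_trans (_ : \sum_(n < N) (A n - A n.+1 - (s n - s n.+1)) <= _); last first.
    by apply: ler_sum => n _.
  rewrite sumrB -(big_mkord xpredT (fun n => A n - A n.+1)).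
  rewrite -(big_mkord xpredT (fun n => s n - s n.+1)).
  rewrite (telescope_sumr_eq (fun n => - A n)) //; last by move=> n _; rewrite opprK addrC.
  rewrite (telescope_sumr_eq (fun n => - s n)) //; last by move=> n _; rewrite opprK addrC.
  have A0 : A 0%N = m 0%N x * phi x by rewrite /A mass0.
  have : A N <= \sum_(y <- B) m N y * phi y.
    by apply: ler_sum => y _; rewrite ler_wpM2r.
  lra.
set E := energy B (w N) (c N) phi phi in key *.
set S1 := \sum_(n < N) energy B (w n) (c n) (density n) (fun=> _) in key self.
set S2 := \sum_(n < N) energy B (w n) (c n) (density n) phi in key lin.
have : 2 * eps * S2 <= 2 * eps * (eps * (m 0%N x * (C / w 0%N x)) + E / (2 * eps)).
  apply: (le_trans key).
  rewrite [leRHS]mulrDr (mulrC _ (E / _)) divfK ?gt_eqF ?mulr_gt0 // lerD2r.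
  have := ler_wpM2l (sqr_ge0 eps) self; lra.
rewrite ler_pM2l ?mulr_gt0 //; lra.
Qed.

End KilledFlow.

(** * Potentials of small energy *)

(** Connection by finitely many edges, without reference to transition probabilities; induction
    peels off the edge farthest from [o]. *)
Inductive linked (R : realType) (V : countType) (c : V -> V -> R) :
    V -> V -> Prop :=
| linked_refl o : linked c o o
| linked_step x y o : 0 < c x y -> linked c y o -> linked c x o.

Section Potential.
Context {R : realType} {V : countType}.
Variables (c : V -> V -> R) (o : V).
Hypothesis c_cond : conductances c.
Hypothesis cfin : finite_total_cond c.

Let c0 u v : 0 <= c u v. Proof. exact: c_cond.1. Qed.
Let cC u v : c u v = c v u. Proof. exact: c_cond.2. Qed.

(** A function of small energy changes little along a path to [o]: each edge bounds its own
    increment, and the tolerance is halved at every edge. [L] lists the vertices of the path. *)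
Lemma linked_gap x : linked c x o -> forall e : R, 0 < e ->
  exists2 d : R, 0 < d & exists L : seq V, forall B (f : V -> R),
    uniq B -> {subset L <= B} -> energy B (weight c) c f f <= d ->
    `|f x - f o| <= e.
Proof.
elim=> {x} [x|x y z cxy _ IH] e e0.
  by exists 1 => //; exists [::] => B f _ _ _; rewrite subrr normr0 ltW.
have e20 : 0 < e / 2 by rewrite divr_gt0.
have [d d0 [L HL]] := IH _ e20.
(* Chosen so that energy at most [d'] forces [(f x - f y) ^+ 2 <= (e / 2) ^+ 2]. *)
pose d' := c x y * (e / 2) ^+ 2 / 2.
have d'0 : 0 < d' by rewrite /d' divr_gt0 // mulr_gt0 // exprn_gt0.
exists (Num.min d d'); first by rewrite lt_min d0.
exists [:: x, y & L] => B f uB LB; rewrite le_min => /andP[Ed Ed'].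
rewrite (_ : f x - f z = (f x - f y) + (f y - f z)); last by ring.
apply: le_trans (ler_normD _ _) _; rewrite [leRHS]splitr lerD //.
  have xB : x \in B by apply: LB; rewrite inE eqxx.
  have yB : y \in B by apply: LB; rewrite !inE eqxx orbT.
  have := energy_ge_edge f c0 cC (fun u => sum_le_weight u c0 cfin uB) xB yB.
  move=> /le_trans /(_ (ler_wpM2l (ler0n _ 2) Ed')).
  rewrite /d' [leRHS]mulrC divfK // ler_pM2l // => sq.
  rewrite -(ler_pXn2r (_ : 0 < 2)%N) // ?nnegrE; last exact: ltW.
  by rewrite real_normK ?num_real.
by apply: HL Ed => // u uL; apply: LB; rewrite !inE uL !orbT.
Qed.

Lemma linked_weight x : linked c x o -> x = o \/ 0 < weight c o.
Proof.
elim=> {x} [x|x y z cxy _ [<-|]]; [by left| |by right].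
by right; apply: lt_le_trans cxy _; rewrite cC; exact: cond_le_weight.
Qed.

(** The law at time [n] of the walk from [o] that stays in [B] before time [n]; summed over [n] it
    is the Green function of the walk killed outside [B]. *)
Fixpoint occupation B n y : R :=
  if n is k.+1 then \sum_(z <- B) occupation B k z * transition c z y
  else (y == o)%:R.

Lemma occupation_ge0 B n y : 0 <= occupation B n y.
Proof.
elim: n y => [|n IH] y /=; first by case: eqP.
by apply: sumr_ge0 => z _; rewrite mulr_ge0 // transition_ge0.
Qed.

Lemma occupation_linked B n y : occupation B n y != 0 -> linked c y o.
Proof.
elim: n y => [|n IH] y /=.
  by have [->|_] := eqVneq y o; [constructor|rewrite eqxx].
move=> /eqP H; have [z [oz tz]] : exists z, occupation B n z != 0 /\ transition c z y != 0.
  apply: contrapT => nz; apply: H; apply: big1 => z _.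
  apply/eqP; rewrite mulf_eq0; apply/orP.
  have [_|oz] := eqVneq (occupation B n z) 0; first by left.
  right; apply: contra_notT nz => tz; by exists z.
have [w0|w0] := eqVneq (weight c z) 0; move: tz.
  by rewrite transition_weight0 //; have [<- _|] := eqVneq z y; [exact: IH|rewrite eqxx].
rewrite transition_weight // mulf_eq0 negb_or => /andP[czy _].
apply: linked_step (IH _ oz); by rewrite lt_def cC czy c0.
Qed.

Hypothesis wo : 0 < weight c o.

(** A walk from [o], which has positive weight, enters new vertices only along edges. This justifies
    dividing by the weight in the Green function below. *)
Let occupation_weight0 B n y : weight c y = 0 -> occupation B n y = 0.
Proof.
move=> wy; elim: n => [|n IH] /=.
  by have [yo|//] := eqVneq y o; move: wo; rewrite -yo wy ltxx.
apply: big1 => z _; have [wz|wz] := eqVneq (weight c z) 0.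
  rewrite transition_weight0 //; have [->|_] := eqVneq z y; last by rewrite mulr0.
  by rewrite IH mul0r.
rewrite transition_weight // (_ : c z y = 0) ?mul0r ?mulr0 //.
by apply/eqP; rewrite eq_le c0 andbT cC -wy; exact: cond_le_weight.
Qed.

(* The Green function of the walk killed outside [B], normalized at [o]. *)
Lemma green_potential B N : uniq B -> o \in B ->
  let T := \sum_(n < N) occupation B n o in 0 < T ->
  exists phi : V -> R, [/\ forall y, 0 <= phi y, phi o = 1,
    forall y, phi y != 0 -> linked c y o
    & energy B (weight c) c phi phi <= weight c o / T].
Proof.
move=> uB oB T T0.
pose a n y := occupation B n y / weight c y.
have a0 n y : 0 <= a n y by rewrite divr_ge0 ?occupation_ge0 ?weight_ge0.
have aw n y : weight c y * a n y = occupation B n y.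
  rewrite /a mulrC; have [w0|w0] := eqVneq (weight c y) 0; last by rewrite divfK.
  by rewrite w0 mulr0 occupation_weight0.
have flow n y : \sum_(z <- B) a n z * c z y = occupation B n.+1 y.
  rewrite /=; apply: eq_bigr => z _; rewrite -[occupation B n z]aw.
  have [w0|w0] := eqVneq (weight c z) 0.
    by rewrite /a w0 invr0 !mulr0 !mul0r.
  by rewrite transition_weight //; field.
pose g y := \sum_(n < N) a n y.
have g0 y : 0 <= g y by exact: sumr_ge0.
have go : g o = T / weight c o by rewrite /g /a -mulr_suml.
have go0 : 0 < g o by rewrite go divr_gt0.
exists (fun y => g y / g o); split => [y| |y|].
- by rewrite divr_ge0.
- by rewrite divff // gt_eqF.
- rewrite mulf_eq0 negb_or => /andP[gy _]; apply: contrapT => nc.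
  move/eqP: gy; apply; apply: big1 => n _; rewrite /a.
  have [->|/occupation_linked //] := eqVneq (occupation B n y) 0.
  by rewrite mul0r.
(* Summing over time telescopes the divergence of [g] to the initial minus the final law; dropping
   the final law then leaves only [g o]. *)
have Eg : energy B (weight c) c g g =
    \sum_(y <- B) (occupation B 0 y - occupation B N y) * g y.
  rewrite energyE; apply: eq_bigr => y _; congr (_ * _).
  have -> : weight c y * g y = \sum_(n < N) occupation B n y.
    by rewrite /g mulr_sumr; apply: eq_bigr => n _; rewrite aw.
  have -> : \sum_(x <- B) g x * c x y = \sum_(n < N) occupation B n.+1 y.
    rewrite /g; under eq_bigr do rewrite mulr_suml.
    by rewrite exchange_big; apply: eq_bigr => n _; rewrite flow.
  rewrite -sumrB -(big_mkord xpredT (fun n => occupation B n y - occupation B n.+1 y)).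
  rewrite (telescope_sumr_eq (fun n => - occupation B n y)) //; first by rewrite opprK addrC.
  by move=> k _; rewrite opprK addrC.
have Ele : energy B (weight c) c g g <= g o.
  rewrite Eg; apply: (@le_trans _ _ (\sum_(y <- B) occupation B 0 y * g y)).
    apply: ler_sum => y _; rewrite ler_wpM2r // gerBl; exact: occupation_ge0.
  rewrite (big_rem o) //= eqxx mul1r big_seq big1 ?addr0 // => y.
  by rewrite mem_rem_uniq // inE => /andP[/negPf yo _]; rewrite yo mul0r.
(* Put in the form of a linear combination to apply bilinearity; the normalized energy is at most
   [(g o)^-1], which is [weight c o / T]. *)
have -> : (fun y => g y / g o) = fun y => (g o)^-1 * g y + 0 * g y.
  by apply/funext => y; rewrite mul0r addr0 mulrC.
rewrite energy_combl energy_combr !mul0r !addr0.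
rewrite -[weight c o / T]invf_div -go mulrA -[leRHS]mulr1.
have gi : 0 < (g o)^-1 by rewrite invr_gt0.
rewrite -mulrA ler_pM2l // mulrC ler_pdivrMr ?mul1r //.
Qed.

(** Recurrence in terms of finite sums: the Green function at [o] is unbounded over finite sets [B],
    even if [B] has to contain prescribed vertices. *)
Definition green_unbounded : Prop :=
  forall (M : R) (L : seq V), exists B N,
    [/\ uniq B, {subset L <= B} & M <= \sum_(n < N) occupation B n o].

End Potential.

(** * Visits and survival of the killed walk *)

Section Killed.
Context {R : realType} {V : countType}.
Variables (c : nat -> V -> V -> R) (cinf : V -> V -> R).
Hypothesis c_cond : forall n, conductances (c n).
Hypothesis cS : forall n u v, c n u v <= c n.+1 u v.
Hypothesis c_cvg : forall u v, c t u v @[t --> \oo] --> cinf u v.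
Hypothesis cfin : finite_total_cond cinf.

Lemma cond_le_lim n u v : c n u v <= cinf u v.
Proof.
rewrite -(cvg_lim _ (@c_cvg u v)) //.
apply: (@nondecreasing_cvgn_le _ (fun t => c t u v)).
  by apply/nondecreasing_seqP => t; exact: cS.
by apply/cvg_ex; exists (cinf u v); exact: c_cvg.
Qed.

Lemma conductances_lim : conductances cinf.
Proof.
split=> [u v|u v]; first exact: le_trans ((c_cond 0%N).1 u v) (cond_le_lim 0%N u v).
apply: (cvg_unique _ (@c_cvg u v)) => //.
rewrite (_ : (fun t => c t u v) = fun t => c t v u); last first.
  by apply/funext => t; exact: (c_cond t).2.
exact: c_cvg.
Qed.

Variables (x o : V) (m : nat -> V -> R) (s : nat -> R).
Hypothesis ms : killed_walk c x o m s.

Let c0 n u v : 0 <= c n u v. Proof. exact: (c_cond n).1. Qed.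
Let ci0 u v : 0 <= cinf u v. Proof. exact: conductances_lim.1. Qed.
Let cnfin n : finite_total_cond (c n).
Proof. by apply: finite_total_cond_le cfin => u v; exact: cond_le_lim. Qed.
Let m0 n y : 0 <= m n y. Proof. by have [/(_ n y)[]] := ms. Qed.

(** Go backwards along a path to [o]. At late times a visit to [y] moves on to the next vertex [z]
    with probability at least a fixed [d]; these moves are bounded by the visits to [z], or by the
    total absorbed mass when [z = o]. *)
Lemma visits_bounded y : linked cinf y o ->
  exists C : R, forall N, \sum_(n < N) m n y <= C.
Proof.
have base : exists C : R, forall N, \sum_(n < N) m n o <= C.
  exists (m 0%N o) => -[|N]; first by rewrite big_ord0.
  rewrite big_ord_recl big1 ?addr0 // => i _ /=.
  by have [/(_ i o)[]] := ms.
move E : o => o' Hy; elim: Hy E => [z <-|{}y z o'' cyz _ IH E]; first exact: base.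
have [C zC] := IH E; subst o''.
have {zC} [C' C'P] : exists C', forall N, \sum_(n < N) m n y * transition (c n) y z <= C'.
  have [_ _ s0 mS mo] := ms.
  have [zo|zo] := eqVneq z o.
    exists (s 0%N) => N; apply: (@le_trans _ _ (\sum_(n < N) (s n - s n.+1))).
      by apply: ler_sum => n _; rewrite zo; have := mo n [:: y] isT; rewrite big_seq1.
    rewrite -(big_mkord xpredT (fun n => s n - s n.+1)).
    rewrite (telescope_sumr_eq (fun n => - s n)) //; last by move=> k _; rewrite opprK addrC.
    by rewrite opprK gerDr oppr_le0.
  exists C => N; apply: le_trans (zC N.+1); rewrite big_ord_recl.
  rewrite -[leLHS]add0r lerD //; apply: ler_sum => n _.
  by have := mS n z [:: y] isT zo; rewrite big_seq1.
have wy : 0 < weight cinf y := lt_le_trans cyz (cond_le_weight y z ci0 cfin).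
(* Eventually [c n y z] exceeds half its limit, while the weight of [y] never exceeds its limit. *)
pose d := cinf y z / 2 / weight cinf y.
have d0 : 0 < d by rewrite /d !divr_gt0.
have [n0 n0P] : exists n0, forall n, (n0 <= n)%N -> d <= transition (c n) y z.
  have half : cinf y z / 2 < cinf y z by lra.
  have [n0 _ n0P] := cvgr_gt _ (@c_cvg y z) _ half.
  exists n0 => n n0n; have cn := n0P n n0n; rewrite /= in cn.
  have wn : 0 < weight (c n) y.
    apply: lt_le_trans (cond_le_weight y z (c0 n) (@cnfin n)).
    by apply: lt_trans cn; rewrite divr_gt0.
  rewrite transition_weight ?gt_eqF // /d.
  apply: ler_pM; [by rewrite divr_ge0|by rewrite invr_ge0 ltW|exact: ltW|].
  rewrite lef_pV2 ?posrE //; apply: weight_le => //; exact: cond_le_lim.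
exists (\sum_(0 <= n < n0) m n y + C' / d) => N.
have dC : \sum_(n < N) m n y * transition (c n) y z / d <= C' / d.
  by rewrite -mulr_suml ler_wpM2r // invr_ge0 ltW.
apply: le_trans (_ : \sum_(0 <= n < n0) m n y
  + \sum_(n < N) m n y * transition (c n) y z / d <= _); last first.
  by rewrite lerD2l.
elim: N {dC} => [|N IHN].
  by rewrite !big_ord0 addr0 sumr_ge0.
have t0 n : 0 <= m n y * transition (c n) y z / d.
  by apply: divr_ge0; [rewrite mulr_ge0 // transition_ge0|exact: ltW].
have [Nn0|n0N] := ltnP N n0.
  rewrite -(big_mkord xpredT (fun n => m n y)) (@big_cat_nat _ _ _ N.+1 0 n0) //=.
  by rewrite -addrA lerDl addr_ge0 // sumr_ge0.
rewrite !big_ord_recr /= addrA lerD // -mulrA ler_peMr //.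
by rewrite ler_pdivlMr // mul1r n0P.
Qed.

Lemma visits_vanish y : linked cinf y o -> m n y @[n --> \oo] --> (0 : R).
Proof.
move=> /visits_bounded[C yC]; apply: cvg_series_cvg_0.
apply: nondecreasing_is_cvgn.
  by apply/nondecreasing_seqP => n; rewrite !seriesEord /= big_ord_recr /= lerDl.
by exists C => _ [n _ <-]; rewrite seriesEord; exact: yC.
Qed.

(** Each of the four terms of [survival_bound] is made at most [e / 4]. First [a] is chosen from the
    visits to [x], then a potential [phi] of energy at most [d], and last [N], which depends on
    [phi]. *)
Lemma survival_vanishes : linked cinf x o -> 0 < weight (c 0%N) x ->
  green_unbounded cinf o -> forall e : R, 0 < e -> exists N, s N <= e.
Proof.
move=> xo wx green e e0.
have ci := conductances_lim.
have wo : 0 < weight cinf o.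
  have [xeqo|//] := linked_weight ci cfin xo.
  rewrite -xeqo; apply: lt_le_trans wx _; apply: weight_le => //; exact: cond_le_lim.
have [C xC] := visits_bounded xo.
have C0 : 0 <= C by have := xC 0%N; rewrite big_ord0.
pose K := m 0%N x * (C / weight (c 0%N) x).
have K0 : 0 <= K by rewrite mulr_ge0 // divr_ge0 // ltW.
pose a := e / 4 / (K + 1).
have K1 : 0 < K + 1 by rewrite ltr_wpDl.
have e40 : 0 < e / 4 by rewrite divr_gt0.
have a0 : 0 < a by rewrite divr_gt0.
have aK : a * K <= e / 4.
  by rewrite /a -mulrA ler_piMr ?ltW // mulrC ltr_pdivrMr // mul1r ltrDl.
have m1 : 0 < m 0%N x + 1 by rewrite ltr_wpDl.
have [d1 d10 [L gap]] := linked_gap ci cfin xo (divr_gt0 e40 m1).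
pose d := Num.min d1 (2 * a * (e / 4)).
have d0 : 0 < d by rewrite lt_min d10 mulr_gt0 // mulr_gt0.
have [B [M [uB LB MT]]] := green (weight cinf o / d) [:: x, o & L].
have T0 : 0 < \sum_(n < M) occupation cinf o B n o.
  by apply: lt_le_trans MT; rewrite divr_gt0.
have xB : x \in B by apply: LB; rewrite inE eqxx.
have oB : o \in B by apply: LB; rewrite !inE eqxx orbT.
have [phi [phi0 phio phic Ephi]] := green_potential ci cfin wo uB oB T0.
have Ed : energy B (weight cinf) cinf phi phi <= d.
  by apply: (le_trans Ephi); rewrite ler_pdivrMr // mulrC -ler_pdivrMr.
have phix : m 0%N x * (1 - phi x) <= e / 4.
  have : `|phi x - phi o| <= e / 4 / (m 0%N x + 1).
    apply: gap uB _ _; first by move=> u uL; apply: LB; rewrite !inE uL !orbT.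
    by apply: (le_trans Ed); rewrite /d ge_min lexx.
  rewrite phio distrC => /(le_trans (ler_norm _)) le1.
  apply: le_trans (ler_wpM2l (m0 0 x) le1) _.
  by rewrite mulrCA ler_piMr ?ltW // ltr_pdivrMr // mul1r ltrDl.
(* The sum is finite, and a vertex where [phi] is nonzero is linked to [o], so the mass there tends
   to zero. *)
have [N _ NP] : \forall N \near \oo, \sum_(y <- B) m N y * phi y < e / 4.
  apply: (@cvgr_lt R _ _ _ _ 0) => //.
  have zero : \sum_(y <- B) (0 : R) = 0 by rewrite big1_eq.
  rewrite -[X in _ --> X]zero; apply: cvg_big => [|y _]; first exact: add_continuous.
  have [->|/phic/visits_vanish yv] := eqVneq (phi y) 0.
    under eq_fun do rewrite mulr0.
    exact: cvg_cst.
  rewrite -[X in _ --> X](mul0r (phi y)).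
  by apply: cvgM => //; exact: cvg_cst.
exists N.
have := survival_bound c_cond cS cnfin ms wx uB xB oB a0 phi0 phio (xC N).
have EN : energy B (weight (c N)) (c N) phi phi / (2 * a) <= e / 4.
  have a20 : 0 < 2 * a by rewrite mulr_gt0.
  rewrite (ler_pdivrMr _ _ a20) mulrC.
  apply: (@le_trans _ _ d); last by rewrite /d ge_min lexx orbT.
  apply: le_trans Ed; apply: energy_le.
  - exact: cond_le_lim.
  - exact: (c_cond N).2.
  - exact: ci.2.
  - move=> u; apply: sum_sub_le_weight => //; exact: cond_le_lim.
have := NP N (leqnn N); rewrite /= -/K; lra.
Qed.

End Killed.

(** * The Markov property *)

Section Cells.
Context {R : realType} d (T : measurableType d) (P : probability T R).
Implicit Types (D E : set T).

Definition pr D : R := fine (P D).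

Lemma prE D : measurable D -> P D = (pr D)%:E.
Proof. by move=> mD; rewrite /pr fineK // fin_num_measure. Qed.

Lemma pr_ge0 D : 0 <= pr D. Proof. exact/fine_ge0/measure_ge0. Qed.

Lemma pr_set0 : pr set0 = 0. Proof. by rewrite /pr measure0. Qed.

Lemma pr_le D E : measurable D -> measurable E -> D `<=` E -> pr D <= pr E.
Proof.
by move=> mD mE DE; rewrite -lee_fin -!prE // le_measure // inE.
Qed.

Lemma prDI D E : measurable D -> measurable E ->
  pr D = pr (D `\` E) + pr (D `&` E).
Proof.
move=> mD mE; apply: EFin_inj; rewrite EFinD -!prE.
- exact: measureDI.
- exact: measurableI.
- exact: measurableD.
- by [].
Qed.

Lemma pr_sum_le (I : eqType) (s : seq I) (E : I -> set T) D :
  uniq s -> measurable D -> (forall i, measurable (E i)) ->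
  (forall i, E i `<=` D) -> (forall i j w, E i w -> E j w -> i = j) ->
  \sum_(i <- s) pr (E i) <= pr D.
Proof.
move=> us mD mE ED Einj.
(* Weakened to indices in [s]: the induction removes the head event from [D], and only the other
   events stay inside. *)
have {ED} : forall i, i \in s -> E i `<=` D by move=> i _; exact: ED.
elim: s us D mD => [|i s IH] /= us D mD ED; first by rewrite big_nil pr_ge0.
move: us => /andP[nis us].
rewrite big_cons (prDI mD (mE i)) addrC lerD //.
  apply: IH => //; first exact: measurableD.
  move=> j js w Ejw; split; first by apply: ED Ejw; rewrite inE js orbT.
  by move=> Eiw; move: nis; rewrite (Einj _ _ _ Eiw Ejw) js.
apply: pr_le => //; first exact: measurableI.
by move=> w Eiw; split=> //; apply: ED Eiw; rewrite mem_head.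
Qed.

Variables (I : countType) (F : I -> set T).
Hypothesis mF : forall i, measurable (F i).
Hypothesis Finj : forall i j w, F i w -> F j w -> i = j.
Hypothesis Fcover : forall w, exists i, F i w.

(** The partition reindexed by [nat], with empty cells at numbers that code no index, so that
    countable additivity over [nat] applies. *)
Definition cell k : set T := if @pickle_inv I k is Some i then F i else set0.

Lemma measurable_cell k : measurable (cell k).
Proof. by rewrite /cell; case: pickle_inv. Qed.

Lemma measure_cells D : measurable D -> P D = (\sum_(k <oo) P (D `&` cell k))%E.
Proof.
move=> mD.
have DE : D = \bigcup_k (D `&` cell k).
  apply/seteqP; split=> [w Dw|w [k _ []//]].
  have [i Fi] := Fcover w; exists (pickle i) => //; split => //.
  by rewrite /cell pickleK_inv.
have mc k : measurable (D `&` cell k) by apply: measurableI => //; exact: measurable_cell.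
rewrite {1}DE measure_semi_bigcup //; last by rewrite -DE.
apply/trivIsetP => i j _ _ ij; apply/seteqP; split=> // w [[_ ci] [_ cj]].
move: ci cj; rewrite /cell.
case Ei : (pickle_inv i) => [a|] //; case Ej : (pickle_inv j) => [b|] // Fa Fb.
have pa : pickle a = i by have := @pickle_invK I i; rewrite Ei.
have pb : pickle b = j by have := @pickle_invK I j; rewrite Ej.
by move: ij; rewrite -pa -pb (Finj Fa Fb) eqxx.
Qed.

(** Otherwise every finite partial sum is at most [pr D - e], and so is [P D] by countable
    additivity. *)
Lemma pr_cells_approx D (e : R) : measurable D -> 0 < e ->
  exists2 s : seq I, uniq s & pr D <= \sum_(i <- s) pr (D `&` F i) + e.
Proof.
move=> mD e0; apply: contrapT => ns.
have : (P D <= (pr D - e)%:E)%E.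
  rewrite measure_cells //; apply: lime_le.
    by apply: is_cvg_nneseries => k _ _; exact: measure_ge0.
  apply: nearW => K.
  pose s := pmap (@pickle_inv I) (iota 0 K).
  have us : uniq s by apply: (pmap_uniq (@pickle_invK I)); exact: iota_uniq.
  have -> : (\sum_(0 <= k < K) P (D `&` cell k))%E = (\sum_(i <- s) pr (D `&` F i))%:E.
    rewrite -sumEFin big_pmap /index_iota subn0; apply: eq_bigr => k _.
    rewrite /cell; case: pickle_inv => [i|] /=; last by rewrite setI0 measure0.
    by rewrite prE //; exact: measurableI.
  rewrite lee_fin lerBrDr leNgt; apply/negP => lt.
  by apply: ns; exists s => //; exact: ltW.
rewrite prE // lee_fin; lra.
Qed.

End Cells.

Section Markov.
Context {R : realType} {V : countType} d (T : measurableType d).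
Context (P : probability T R) (X : nat -> T -> V) (p : nat -> V -> V -> R) (v : V).
Hypothesis mc : markov_chain P X p v.

Lemma measurable_fiber t y : measurable [set w | X t w = y].
Proof. by have [mX _ _] := mc; exact: mX. Qed.

Lemma measurable_path n (x : nat -> V) :
  measurable [set w | forall s, (s <= n)%N -> X s w = x s].
Proof.
rewrite (_ : [set w | _] = \bigcap_(s in [set s | (s <= n)%N]) [set w | X s w = x s]) //.
apply: bigcap_measurable; first by exists 0%N.
by move=> s _; exact: measurable_fiber.
Qed.

(** Sets of trajectories determined by the times up to [n]; as [V] is countable, each of them gives
    a measurable event. *)
Definition past (n : nat) (Q : set (nat -> V)) : Prop :=
  forall x x', (forall s, (s <= n)%N -> x s = x' s) -> Q x -> Q x'.

Let path_cell n y (u : n.+1.-tuple V) : set T :=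
  [set w | forall s, (s <= n)%N -> X s w = nth y u s].

Let path_cell_inj n y (u u' : n.+1.-tuple V) w :
  path_cell y u w -> path_cell y u' w -> u = u'.
Proof.
move=> uw u'w; apply: val_inj; apply: (@eq_from_nth _ y); first by rewrite !size_tuple.
by move=> s; rewrite size_tuple ltnS => sn; rewrite -uw // -u'w.
Qed.

Let path_cell_cover n y w : exists u : n.+1.-tuple V, path_cell y u w.
Proof.
exists [tuple X i w | i < n.+1] => s; rewrite -ltnS => sn.
by rewrite -(tnth_nth y _ (Ordinal sn)) tnth_mktuple.
Qed.

Lemma measurable_past n Q : past n Q -> measurable [set w | Q (fun s => X s w)].
Proof.
move=> pQ; have [[w0 _]|nT] := pselect (exists w : T, True); last first.
  rewrite (_ : [set w | _] = set0) //; apply/seteqP; split=> // w _.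
  by apply: nT; exists w.
pose y := X 0%N w0.
rewrite (_ : [set w | _] = \bigcup_(u in setT)
   (if `[< Q (nth y (u : n.+1.-tuple V)) >] then path_cell y u else set0)).
  apply: countable_bigcupT_measurable => // u; case: ifP => // _.
  exact: measurable_path.
apply/seteqP; split=> [w Qw|w [u _]].
  have [u uw] := path_cell_cover n y w; exists u => //.
  by rewrite asboolT //; apply: pQ Qw => s sn; rewrite uw.
by case: asboolP => // Qu uw; apply: pQ Qu => s sn; rewrite uw.
Qed.

(** Split over the countably many paths up to time [n]: on a path in [Q] the product formula of
    [markov_chain] applies, and all other paths contribute zero to both sides. *)
Lemma markov_property n Q y z : past n Q -> (forall x, Q x -> x n = y) ->
  pr P ([set w | Q (fun s => X s w)] `&` [set w | X n.+1 w = z]) =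
  pr P [set w | Q (fun s => X s w)] * p n y z.
Proof.
move=> pQ Qy; set A := [set w | _]; set Z := [set w | _].
have mA : measurable A := measurable_past pQ.
have mZ : measurable Z := measurable_fiber _ _.
have mAZ : measurable (A `&` Z) by exact: measurableI.
have mcell u : measurable (@path_cell n y u) by exact: measurable_path.
have cells := measure_cells P mcell (@path_cell_inj n y) (@path_cell_cover n y).
apply: EFin_inj; rewrite mulrC EFinM -!prE // (cells A) // -nneseriesZl; last first.
  by move=> k _; exact: measure_ge0.
rewrite (cells (A `&` Z)) //; apply: eq_eseriesr => k _; rewrite /cell.
case: pickle_inv => [u|]; last by rewrite !setI0 measure0 mule0.
have [Qu|nQu] := pselect (Q (nth y u)); last first.
  have A0 : A `&` path_cell y u = set0.
    apply/seteqP; split=> // w [Aw uw]; apply: nQu.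
    by apply: pQ Aw => s sn; rewrite uw.
  by rewrite setIAC A0 set0I measure0 mule0.
pose x s := if s == n.+1 then z else nth y u s.
have xs s : (s <= n)%N -> x s = nth y u s.
  by move=> sn; rewrite /x ltn_eqF.
have -> : A `&` path_cell y u = [set w | forall s, (s <= n)%N -> X s w = x s].
  apply/seteqP; split=> [w [_ uw] s sn|w xw]; first by rewrite xs // uw.
  have uw : path_cell y u w by move=> s sn; rewrite xw // xs.
  by split=> //; apply: pQ Qu => s sn; rewrite uw.
have -> : A `&` Z `&` path_cell y u = [set w | forall s, (s <= n.+1)%N -> X s w = x s].
  apply/seteqP; split=> [w [[_ Zw] uw] s|w xw].
    rewrite leq_eqVlt ltnS => /orP[/eqP ->|sn]; last by rewrite xs // uw.
    by rewrite /x eqxx.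
  have uw : path_cell y u w by move=> s sn; rewrite xw ?leqW // xs.
  split=> //; split; last by rewrite /Z /= xw // /x eqxx.
  by apply: pQ Qu => s sn; rewrite uw.
have [_ _ ->] := mc.
by rewrite muleC xs // (Qy _ Qu) /x eqxx.
Qed.

End Markov.

(** * Survival probabilities *)

Section Survival.
Context {R : realType} {V : countType} d (T : measurableType d).
Context (P : probability T R) (X : nat -> T -> V) (c : nat -> V -> V -> R) (v : V).
Hypothesis rw : random_walk P X c v.

(** Time [t] itself is not tested, so [x = o] is allowed and the event then concerns returns. *)
Definition avoids (t : nat) (x o : V) (n : nat) : set T :=
  [set w | X t w = x /\ forall s, (t < s <= t + n)%N -> X s w <> o].

Definition never_hits (t : nat) (x o : V) : set T :=
  [set w | X t w = x /\ forall s, (t < s)%N -> X s w <> o].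

Let past_avoids t x o n :
  past (t + n) [set f : nat -> V | f t = x /\ forall s, (t < s <= t + n)%N -> f s <> o].
Proof.
move=> f f' ff' [ft fs]; split; first by rewrite -ff' // leq_addr.
by move=> s /[dup] /fs + /andP[_ sn]; rewrite ff'.
Qed.

Lemma measurable_avoids t x o n : measurable (avoids t x o n).
Proof. exact (measurable_past rw (past_avoids (t:=t) (x:=x) (o:=o) (n:=n))). Qed.

Let mfiber t y : measurable [set w | X t w = y].
Proof. exact: measurable_fiber rw t y. Qed.

Let mass t x o n y : R := pr P (avoids t x o n `&` [set w | X (t + n)%N w = y]).

Let mass_step t x o n y z :
  mass t x o n y * transition (c (t + n)%N) y z =
  pr P (avoids t x o n `&` [set w | X (t + n)%N w = y] `&` [set w | X (t + n).+1 w = z]).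
Proof.
pose Q := [set f : nat -> V | (f t = x /\ forall s, (t < s <= t + n)%N -> f s <> o)
                              /\ f (t + n)%N = y].
have pQ : past (t + n) Q.
  by move=> f f' ff' [/(past_avoids ff') ? fy]; split; rewrite // -ff'.
by have := markov_property rw z pQ (fun f (Qf : Q f) => Qf.2).
Qed.

(** The walk is watched from time [t] on, hence the shifted environment. Moves from different
    vertices are disjoint events, and survival drops by the probability of hitting [o] at the next
    time. *)
Lemma killed_walk_avoids t x o :
  killed_walk (fun n => c (t + n)%N) x o (mass t x o) (fun n => pr P (avoids t x o n)).
Proof.
have mS n := measurable_avoids t x o n.
have mSy n y : measurable (avoids t x o n `&` [set w | X (t + n)%N w = y]).
  exact: measurableI.
split.
- move=> n y; split; first exact: pr_ge0.
  rewrite /mass (_ : _ `&` _ = set0) ?pr_set0 //.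
  apply/seteqP; split=> // w [[_ av] Xo]; apply: av Xo.
  by rewrite addnS ltnS leq_addr leqnn.
- apply: pr_le => // w [Xx av]; split; first by split.
  by rewrite /= addn0.
- by move=> n; exact: pr_ge0.
- move=> n y B uB yo; under eq_bigr do rewrite mass_step.
  apply: pr_sum_le => //.
  + by move=> z; exact: measurableI.
  + move=> z w [[[Xx av] Xz] Xy]; split; last by rewrite /= addnS.
    split=> // s /andP[ts]; rewrite addnS leq_eqVlt ltnS => /orP[/eqP ->|sn].
      by rewrite Xy; exact/eqP.
    by apply: av; rewrite ts.
  + by move=> z z' w [[_ /= <-] _] [[_ /= <-] _].
- move=> n B uB; under eq_bigr do rewrite mass_step.
  have mo : measurable [set w | X (t + n).+1 w = o] by exact: mfiber.
  have -> : pr P (avoids t x o n) - pr P (avoids t x o n.+1)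
    = pr P (avoids t x o n `&` [set w | X (t + n).+1 w = o]).
    rewrite (prDI P (mS n) mo) (_ : _ `\` _ = avoids t x o n.+1).
      by rewrite addrAC subrr add0r.
    apply/seteqP; split=> [w [[Xx av] Xo]|w [Xx av]].
      split=> // s /andP[ts]; rewrite addnS leq_eqVlt ltnS => /orP[/eqP -> //|sn].
      by apply: av; rewrite ts.
    split; last by apply: av; rewrite addnS ltnS leq_addr leqnn.
    split=> // s /andP[ts sn]; apply: av; by rewrite ts addnS leqW.
  apply: pr_sum_le => //.
  + exact: measurableI.
  + by move=> z; exact: measurableI.
  + by move=> z w [[? _] ?].
  + by move=> z z' w [[_ /= <-] _] [[_ /= <-] _].
Qed.

Lemma measurable_never_hits t x o : measurable (never_hits t x o).
Proof.
rewrite (_ : never_hits t x o = \bigcap_(n in setT) avoids t x o n).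
  by apply: bigcap_measurable => [|n _]; [exists 0%N|exact: measurable_avoids].
apply/seteqP; split=> [w [Xx av] n _|w av].
  by split=> // s /andP[ts _]; exact: av.
split; first by have [] := av 0%N I.
move=> s ts; have [_] := av s I; apply; by rewrite ts leq_addl.
Qed.

(* At a vertex of weight zero the walk stays put. *)
Let leave_null t x : weight (c t) x = 0 ->
  pr P ([set w | X t w = x] `\` [set w | X t.+1 w = x]) = 0.
Proof.
move=> w0; have pQ : past t [set f : nat -> V | f t = x].
  by move=> f f' ff' /= <-; rewrite ff'.
have := markov_property rw x pQ (fun f (Qf : f t = x) => Qf).
rewrite transition_weight0 // eqxx mulr1 => stay.
have := prDI P (mfiber t x) (mfiber t.+1 x); rewrite stay.
by move/eqP; rewrite -subr_eq subrr => /eqP.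
Qed.

Variable cinf : V -> V -> R.
Hypothesis c_cond : forall n, conductances (c n).
Hypothesis cS : forall n u w, c n u w <= c n.+1 u w.
Hypothesis c_cvg : forall u w, c t u w @[t --> \oo] --> cinf u w.
Hypothesis cfin : finite_total_cond cinf.

Let c0 n u w : 0 <= c n u w. Proof. exact: (c_cond n).1. Qed.

Let never_hits_null_weight t x o : linked cinf x o ->
  green_unbounded cinf o -> 0 < weight (c t) x -> pr P (never_hits t x o) = 0.
Proof.
move=> xo green wx; apply/eqP; rewrite eq_le pr_ge0 andbT.
apply/ler_addgt0Pl => e e0; rewrite addr0.
have shift u w : c (t + n)%N u w @[n --> \oo] --> cinf u w.
  rewrite (_ : (fun n => _) = [sequence c (n + t)%N u w]_n).
    by rewrite (cvg_shiftn t (fun n => c n u w)); exact: c_cvg.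
  by apply/funext => n; rewrite addnC.
have [|||N NP] := survival_vanishes _ _ shift cfin (killed_walk_avoids t x o) xo _ green e0.
- by move=> n; exact: c_cond.
- by move=> n u w; rewrite addnS; exact: cS.
- by rewrite addn0.
apply: le_trans NP; apply: pr_le.
- exact: measurable_never_hits.
- exact: measurable_avoids.
- by move=> w [Xx av]; split=> // s /andP[ts _]; exact: av.
Qed.

(** What remains is a start of weight zero at time [t], where the walk almost surely waits. If the
    limit weight of [x] is positive, [x] has weight from some time [t0] on; otherwise [x = o], and
    waiting is a return. *)
Lemma never_hits_null t x o : linked cinf x o ->
  green_unbounded cinf o -> pr P (never_hits t x o) = 0.
Proof.
move=> xo green.
have cle := cond_le_lim cS c_cvg.
have ci := conductances_lim c_cond cS c_cvg.
have w0 n u : 0 <= weight (c n) u by exact: weight_ge0.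
have [wi|wi] := eqVneq (weight cinf x) 0.
  have wt0 : weight (c t) x = 0.
    by apply/eqP; rewrite eq_le w0 andbT -wi; exact: weight_le.
  have xeqo : x = o.
    case: xo wi => // x' y' o' cxy _ wx'; move: cxy.
    by rewrite ltNge -wx' cond_le_weight //; exact: ci.1.
  apply/eqP; rewrite eq_le pr_ge0 andbT -(leave_null wt0); apply: pr_le.
  - exact: measurable_never_hits.
  - exact: measurableD.
  - move=> w [Xx av]; split=> //=; rewrite xeqo; exact: av.
have [y xy] : exists y, cinf x y != 0.
  apply: contrapT => ny; move/eqP: wi; apply; rewrite /weight /total_cond esum1 // => z _.
  by apply/eqP; rewrite eqe; apply: contra_notT ny => ?; exists z.
have xy0 : 0 < cinf x y by rewrite lt_def xy ci.1.
have [t0 _ t0P] := cvgr_gt _ (@c_cvg x y) _ xy0.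
have wpos n : (t0 <= n)%N -> 0 < weight (c n) x.
  move=> /t0P /= /lt_le_trans; apply; apply: cond_le_weight => //.
  exact: finite_total_cond_le (cle n) cfin.
(* Induction on a bound [k] for the time left until [t0]. *)
suff H : forall k n, (t0 <= n + k)%N -> pr P (never_hits n x o) = 0.
  by apply: (H t0); rewrite leq_addl.
elim=> [|k IH] n tn.
  by apply: never_hits_null_weight => //; apply: wpos; rewrite -(addn0 n).
have [wn|wn] := eqVneq (weight (c n) x) 0; last first.
  by apply: never_hits_null_weight => //; rewrite lt_def wn w0.
apply/eqP; rewrite eq_le pr_ge0 andbT.
(* Either the walk leaves [x] at once, which is a null event, or it is still at [x] at time [n.+1],
   where the induction hypothesis applies. *)
have mX := measurableD (mfiber n x) (mfiber n.+1 x).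
rewrite (prDI P (measurable_never_hits n x o) mX).
rewrite -[leRHS]addr0 lerD //.
  rewrite -(IH n.+1); last by rewrite addSnnS.
  apply: pr_le.
  - by apply: measurableD => //; exact: measurable_never_hits.
  - exact: measurable_never_hits.
  - move=> w [[Xx av] nX]; split; last by move=> s ns; apply: av; exact: ltnW.
    by apply: contrapT => Xn; apply: nX.
rewrite -(leave_null wn); apply: pr_le => //.
by apply: measurableI => //; exact: measurable_never_hits.
Qed.

End Survival.

(** * Recurrence *)

Lemma ler_sum_subset (R : numDomainType) (I : eqType) (s1 s2 : seq I) (F : I -> R) :
  uniq s1 -> uniq s2 -> {subset s1 <= s2} -> (forall i, 0 <= F i) ->
  \sum_(i <- s1) F i <= \sum_(i <- s2) F i.
Proof.
move=> u1 u2 s12 F0.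
have -> : \sum_(i <- s1) F i = \sum_(i <- s2 | i \in s1) F i.
  rewrite -[RHS]big_filter; apply: perm_big; apply: uniq_perm => //.
    exact: filter_uniq.
  by move=> i; rewrite mem_filter andb_idr // => /s12.
by rewrite [leRHS](bigID (mem s1)) /= lerDl sumr_ge0.
Qed.

Section Recurrence.
Context {R : realType} {V : countType} d (T : measurableType d).
Context (P : probability T R) (Y : nat -> T -> V) (c : V -> V -> R) (o : V).
Hypothesis rw : random_walk P Y (fun=> c) o.
Hypothesis c_cond : conductances c.

Let c0 u w : 0 <= c u w. Proof. exact: c_cond.1. Qed.
Let law n y : R := pr P [set w | Y n w = y].
Let mfiber n y : measurable [set w | Y n w = y].
Proof. exact: measurable_fiber rw n y. Qed.

Let lawS n y z :
  pr P ([set w | Y n.+1 w = z] `&` [set w | Y n w = y]) = law n y * transition c y z.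
Proof.
have pQ : past n [set f : nat -> V | f n = y].
  by move=> f f' ff' /= <-; rewrite ff'.
by rewrite setIC; exact: (markov_property rw z pQ (fun f (Qf : f n = y) => Qf)).
Qed.

(* The walk killed outside [B] approximates the walk as [B] grows. *)
Lemma law_le_occupation n y (e : R) : 0 < e ->
  exists L : seq V, forall B, uniq B -> {subset L <= B} ->
    law n y <= occupation c o B n y + e.
Proof.
elim: n y e => [|n IH] y e e0.
  exists [::] => B _ _ /=.
  have [->|yo] := eqVneq y o.
    apply: le_trans (_ : 1 <= _); last by rewrite lerDl ltW.
    by rewrite -lee_fin -prE // probability_le1.
  (* The disjoint events of being at [y] and at [o] have total probability at most one, and the
     second has probability one. *)
  rewrite (_ : law 0 y = 0) ?add0r ?ltW //.
  have [_ Y0 _] := rw.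
  have m1 : 1 <= pr P [set w | Y 0%N w = o] by rewrite /pr Y0.
  apply/eqP; rewrite eq_le pr_ge0 andbT.
  have := @pr_sum_le R _ T P _ [:: y; o] (fun z => [set w | Y 0%N w = z]) setT.
  rewrite big_cons big_seq1 /= inE yo => /(_ isT measurableT (mfiber 0)) le1.
  have : law 0 y + pr P [set w | Y 0%N w = o] <= pr P setT.
    by apply: le1 => // z z' w /= <- <-.
  have -> : pr P setT = 1 by rewrite /pr probability_setT.
  lra.
have e2 : 0 < e / 2 by rewrite divr_gt0.
have [s us sP] := pr_cells_approx P (mfiber n)
  (fun i j w (Yi : Y n w = i) (Yj : Y n w = j) => etrans (esym Yi) Yj)
  (fun w => ex_intro _ (Y n w) erefl) (mfiber n.+1 y) e2.
have {sP} sP : law n.+1 y <= \sum_(z <- s) law n z * transition c z y + e / 2.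
  by apply: le_trans sP _; rewrite lerD2r; apply: ler_sum => z _; rewrite lawS.
(* Finitely many terms, each approximated by the induction hypothesis; adding one to the transition
   probability keeps the denominator positive. *)
have [L LP] : exists L : seq V, forall B, uniq B -> {subset L <= B} ->
    \sum_(z <- s) law n z * transition c z y <=
    \sum_(z <- s) occupation c o B n z * transition c z y + e / 2.
  elim: s {us sP} (e / 2) e2 => [|z s IHs] e' e'0.
    by exists [::] => B _ _; rewrite !big_nil add0r ltW.
  have e'2 : 0 < e' / 2 by rewrite divr_gt0.
  have t1 : 0 < transition c z y + 1 by rewrite ltr_wpDl ?transition_ge0.
  have [L1 L1P] := IHs _ e'2.
  have [L2 L2P] := IH z (e' / 2 / (transition c z y + 1)) (divr_gt0 e'2 t1).
  exists (L1 ++ L2) => B uB LB; rewrite !big_cons.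
  have h1 : \sum_(z <- s) law n z * transition c z y <=
    \sum_(z <- s) occupation c o B n z * transition c z y + e' / 2.
    by apply: L1P => // u uL; apply: LB; rewrite mem_cat uL.
  have h2 : law n z <= occupation c o B n z + e' / 2 / (transition c z y + 1).
    by apply: L2P => // u uL; apply: LB; rewrite mem_cat uL orbT.
  have := ler_wpM2r (transition_ge0 z y c0) h2; rewrite mulrDl => h3.
  have : e' / 2 / (transition c z y + 1) * transition c z y <= e' / 2.
    rewrite -mulrA ler_piMr ?ltW // mulrC ltr_pdivrMr // mul1r; lra.
  lra.
exists (s ++ L) => B uB LB.
have h1 : \sum_(z <- s) law n z * transition c z y <=
    \sum_(z <- s) occupation c o B n z * transition c z y + e / 2.
  by apply: LP => // u uL; apply: LB; rewrite mem_cat uL orbT.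
have : \sum_(z <- s) occupation c o B n z * transition c z y <= occupation c o B n.+1 y.
  apply: ler_sum_subset => //.
    by move=> u us'; apply: LB; rewrite mem_cat us'.
  by move=> z; rewrite mulr_ge0 ?transition_ge0 // occupation_ge0.
lra.
Qed.

(** By Borel-Cantelli, a bounded expected number of visits would make visits almost surely finite in
    number. A large finite sum of [law] is then transferred to the walk killed outside a large
    [B]. *)
Lemma infinite_visits_green :
  {ae P, forall w, infinite_set [set t | Y t w = o]} -> green_unbounded c o.
Proof.
move=> io.
have big M : exists N, M <= \sum_(n < N) law n o.
  apply: contrapT => nM.
  have fin : (\sum_(n <oo) P [set w | Y n w = o] < +oo)%E.
    apply: (@le_lt_trans _ _ M%:E); last exact: ltry.
    apply: lime_le; first by apply: is_cvg_nneseries => k _ _; exact: measure_ge0.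
    apply: nearW => N; rewrite big_mkord.
    under eq_bigr do rewrite prE //.
    rewrite sumEFin lee_fin leNgt; apply/negP => lt.
    by apply: nM; exists N; exact: ltW.
  have lim0 := lim_sup_set_cvg0 (fun n => mfiber n o) fin.
  have mlim : measurable (lim_sup_set (fun n => [set w | Y n w = o])).
    apply: bigcap_measurable; first by exists 0%N.
    by move=> n _; apply: bigcup_measurable => k _; exact: mfiber.
  have neg : P.-negligible (lim_sup_set (fun n => [set w | Y n w = o])).
    exact/negligibleP.
  (* Two null sets would cover the whole space. *)
  have : P.-negligible [set: T].
    apply: negligibleS (negligibleU io neg) => w _.
    have [iow|] := pselect (infinite_set [set t | Y t w = o]); last by left.
    by right => n _; have /infinite_setN0[k [Yk /negP]] := infinite_setD iow (finite_II n);
      rewrite -leqNgt => nk; exists k.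
  move=> /(negligibleP _ measurableT) PT.
  by have /eqP := etrans (esym PT) (probability_setT P); rewrite eq_sym onee_eq0.
move=> M L; have [N MN] := big (M + 1).
have approx (e : R) : 0 < e -> exists L' : seq V, forall B, uniq B -> {subset L' <= B} ->
    \sum_(n < N) law n o <= \sum_(n < N) occupation c o B n o + e.
  elim: N {MN} e => [|N IH] e e0.
    by exists [::] => B _ _; rewrite !big_ord0 add0r ltW.
  have e2 : 0 < e / 2 by rewrite divr_gt0.
  have [L1 L1P] := IH _ e2; have [L2 L2P] := law_le_occupation N o e2.
  exists (L1 ++ L2) => B uB LB; rewrite !big_ord_recr /=.
  have h1 : \sum_(n < N) law n o <= \sum_(n < N) occupation c o B n o + e / 2.
    by apply: L1P => // u uL; apply: LB; rewrite mem_cat uL.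
  have h2 : law N o <= occupation c o B N o + e / 2.
    by apply: L2P => // u uL; apply: LB; rewrite mem_cat uL orbT.
  lra.
have [L' L'P] := approx 1 ltr01.
exists (undup (L ++ L')), N; split; first exact: undup_uniq.
  by move=> u uL; rewrite mem_undup mem_cat uL.
have : \sum_(n < N) law n o <= \sum_(n < N) occupation c o (undup (L ++ L')) n o + 1.
  by apply: L'P; [exact: undup_uniq|move=> u uL; rewrite mem_undup mem_cat uL orbT].
lra.
Qed.

End Recurrence.

Lemma recurrent_at_green (R : realType) (V : countType) (c : V -> V -> R) (o : V) :
  conductances c -> recurrent_at c o -> green_unbounded c o.
Proof.
move=> c_cond [d [T [P [Y [rw io]]]]]; exact: infinite_visits_green rw c_cond io.
Qed.

(** A step of positive probability follows an edge or stays put at a vertex of weight zero, so a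
    nonzero [n]-step probability yields a path. *)
Lemma irreducible_linked (R : realType) (V : countType) (c : V -> V -> R) :
  irreducible (transition c) -> (forall x y, 0 <= c x y) -> forall x y, linked c x y.
Proof.
move=> irr c0 x y; have [n] := irr x y.
rewrite lt_def => /andP[+ _].
elim: n x => [|n IH] x /=.
  by have [->|_] := eqVneq x y; [constructor|rewrite eqxx].
move=> xy; have [z] : exists z, ((transition c x z)%:E * nstep (transition c) n z y != 0)%E.
  apply: contrapT => nz; move/eqP: xy; apply; apply: esum1 => z _.
  by apply/eqP; apply: contra_notT nz => ?; exists z.
rewrite mule_eq0 negb_or eqe => /andP[xz /IH zy].
have [w0|w0] := eqVneq (weight c x) 0; move: xz.
  by rewrite transition_weight0 //; have [->|_] := eqVneq x z; [|rewrite eqxx].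
rewrite transition_weight // mulf_eq0 negb_or => /andP[cxz _].
by apply: linked_step zy; rewrite lt_def cxz c0.
Qed.

(** * Almost sure recurrence in the changing environment *)

Lemma negligible_bigcup_count (R : realType) d (T : measurableType d)
    (P : probability T R) (I : countType) (F : I -> set T) :
  (forall i, P.-negligible (F i)) -> P.-negligible (\bigcup_i F i).
Proof.
move=> nF.
apply: (@negligibleS _ _ _ _ (\bigcup_k (if @pickle_inv I k is Some i then F i else set0))).
  by move=> w [i _ Fi]; exists (pickle i) => //; rewrite pickleK_inv.
apply: negligible_bigcup => k; case: pickle_inv => [i|] //; exact: negligible_set0.
Qed.

Lemma finite_visits_last (V : Type) (X : nat -> V) (o : V) :
  ~ infinite_set [set t | X t = o] -> exists t, forall s, (t < s)%N -> X s <> o.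
Proof.
move=> /contrapT fin; have [t tP] : exists t, forall s, X s = o -> (s <= t)%N.
  have /finite_seqP[r rE] := fin; exists (\max_(s <- r) s)%N => s Xs.
  have : [set t | X t = o] s by [].
  by rewrite rE => sr; exact: leq_bigmax_seq.
by exists t => s ts Xs; have := tP s Xs; rewrite leqNgt ts.
Qed.

Theorem theorem1p6 (R : realType) (V : countType) :
  (forall (c : nat -> V -> V -> R) (cinf : V -> V -> R),
     (forall t, conductances (c t)) ->
     (forall t u v, c t u v <= c t.+1 u v) ->
     (forall u v, c t u v @[t --> \oo] --> cinf u v) ->
     finite_total_cond cinf ->
     irreducible (transition cinf) ->
     recurrent cinf ->
     forall (x0 : V) (d : measure_display) (T : measurableType d)
       (P : probability T R) (X : nat -> T -> V),
       random_walk P X c x0 ->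
       {ae P, forall w, forall v, infinite_set [set t | X t w = v]})
  /\
  (forall (Ginf : rel V) (G : nat -> rel V) (v0 : V),
     symmetric Ginf ->
     bounded_degree Ginf ->
     (forall t, symmetric (G t)) ->
     (forall t u v, G t u v -> G t.+1 u v) ->
     (forall u v, Ginf u v <-> exists t, G t u v) ->
     recurrent_at (graph_cond R Ginf) v0 ->
     forall (d : measure_display) (T : measurableType d)
       (P : probability T R) (X : nat -> T -> V),
       random_walk P X (fun t => graph_cond R (G t)) v0 ->
       {ae P, forall w, infinite_set [set t | X t w = v0]}).
Proof.
split.
  move=> c cinf c_cond cS c_cvg cfin irr rec x0 d T P X rw.
  have ci := conductances_lim c_cond cS c_cvg.
  have null t x v : P.-negligible (never_hits X t x v).
    apply/negligibleP; first exact: (measurable_never_hits rw).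
    apply: etrans (prE P (measurable_never_hits rw t x v)) _.
    rewrite (never_hits_null rw c_cond cS c_cvg cfin t) //.
      exact: irreducible_linked irr ci.1 x v.
    exact: recurrent_at_green ci (rec v).
  (* If [v] is visited finitely often, then from some time [t] and position [x] on it is never hit;
     these are countably many null events. *)
  apply: negligibleS (negligible_bigcup_count (fun v : V =>
    negligible_bigcup (fun t => negligible_bigcup_count (fun x : V => null t x v)))).
  move=> w /= /existsNP[v nv].
  have [t tP] := @finite_visits_last V (X^~ w) v nv.
  by exists v => //; exists t => //; exists (X t w).
move=> Ginf G v0 Gs [D GD] Gts GS Glim rec d T P X rw.
pose c t := graph_cond R (G t); pose cinf := graph_cond R Ginf.
have c_cond t : conductances (c t).
  by split=> u v; rewrite /c /graph_cond ?ler0n // Gts.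
have cS t u v : c t u v <= c t.+1 u v.
  rewrite /c /graph_cond ler_nat; have := GS t u v.
  by case: (G t u v) => // ->.
have Gmono s t u v : (s <= t)%N -> G s u v -> G t u v.
  move=> st; rewrite -(subnK st); elim: (t - s)%N => // k IH Gs'.
  by rewrite addSn; apply: GS; exact: IH.
have c_cvg u v : c t u v @[t --> \oo] --> cinf u v.
  apply: cvg_near_cst; rewrite /c /cinf /graph_cond.
  case Guv: (Ginf u v).
    have [s Gsuv] := (Glim u v).1 Guv.
    by exists s => // t st; rewrite /= (Gmono s t).
  apply: nearW => t; case Gt : (G t u v) => //.
  by have := (Glim u v).2 (ex_intro _ t Gt); rewrite Guv.
have cfin : finite_total_cond cinf.
  move=> y; have := GD y => yD.
  have fy : finite_set [set z | Ginf y z] by apply/finite_set_leP; exists D.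
  have -> : total_cond cinf y = \esum_(z in [set z | Ginf y z]) 1%:E.
    rewrite esum_mkcond; apply: eq_esum => z _; rewrite /cinf /graph_cond.
    by case: ifPn => [/set_mem /= -> //|]; rewrite notin_setE /= => /negP/negPf ->.
  rewrite esum_fset // fsbig_finite //= sumEFin; exact: ltry.
have ci := conductances_lim c_cond cS c_cvg.
(* Start and target are both [v0], so the trivial path links them, and recurrence at [v0] supplies
   the unbounded Green function. *)
have null t : P.-negligible (never_hits X t v0 v0).
  apply/negligibleP; first exact: (measurable_never_hits rw).
  apply: etrans (prE P (measurable_never_hits rw t v0 v0)) _.
  rewrite (never_hits_null rw c_cond cS c_cvg cfin t) //.
    exact: linked_refl.
  exact: recurrent_at_green ci rec.
have start : P.-negligible (~` [set w | X 0%N w = v0]).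
  have [mX X0 _] := rw.
  apply/negligibleP; first exact: measurableC.
  by apply: etrans (probability_setC P (mX 0%N v0)) _; rewrite X0 subee.
apply: negligibleS (negligibleU start (negligible_bigcup null)).
move=> w /= nv; have [t tP] := @finite_visits_last V (X^~ w) v0 nv.
have [X0|] := pselect (X 0%N w = v0); last by left.
(* Going back from [t] to the latest visit to [v0], which exists since the walk starts there, gives
   a time after which [v0] is never hit. *)
right; elim: t tP => [|t IH] tP; first by exists 0%N.
have [Xt|Xt] := pselect (X t.+1 w = v0); first by exists t.+1.
apply: IH => s; rewrite leq_eqVlt => /orP[/eqP <-//|]; exact: tP.
Qed.
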